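(* Let $n\geq2$. The complement in $\mathbb{R}^n$ of an open (Euclidean) ball of $\mathbb{R}^n$ is a polynomial image of $\mathbb{R}^n$.
   Context: A set $S\subset\mathbb{R}^n$ is a polynomial image of $\mathbb{R}^n$ if $S=f(\mathbb{R}^n)$ for some map $f:\mathbb{R}^n\to\mathbb{R}^n$ with polynomial components. Balls have positive finite radius. *)

(* Defs.v *)
From mathcomp Require Import all_boot all_order all_algebra.
From mathcomp Require Import classical_sets reals.
From mathcomp Require Import mpoly.

Set Implicit Arguments.
Unset Strict Implicit.
Unset Printing Implicit Defensive.

Import Order.TTheory GRing.Theory Num.Theory.
Local Open Scope classical_set_scope.
Local Open Scope ring_scope.

Section PolynomialImages.
Variable R : realType.

(* MathComp-Analysis equips 'rV[R]_n with the sup norm, hence this explicit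
   Euclidean norm. *)
Definition enorm n (x : 'rV[R]_n) : R := Num.sqrt (\sum_i x 0 i ^+ 2).

Definition open_eball n (c : 'rV[R]_n) (r : R) : set 'rV[R]_n :=
  [set x | enorm (x - c) < r].

Definition polynomial_map m n (f : 'rV[R]_m -> 'rV[R]_n) : Prop :=
  exists p : 'I_n -> {mpoly R[m]}, forall x i, f x 0 i = (p i).@[x 0].

Definition polynomial_image m n (S : set 'rV[R]_n) : Prop :=
  exists2 f : 'rV[R]_m -> 'rV[R]_n, polynomial_map f & S = range f.

End PolynomialImages.

Arguments polynomial_image {R} m {n} S.

(* Main.v *)
Require Import Defs.
From mathcomp Require Import all_boot all_order all_algebra.
From mathcomp Require Import classical_sets reals.
From mathcomp Require Import mpoly ring lra.
Local Open Scope classical_set_scope.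
Local Open Scope ring_scope.

(** For [z = (a, b)] in [R * R^(n-1)] put [h z = (a^2 - |b|^2, 2 a b)]; then
    [|h z| = |z|^2], and [h] doubles the angle to the first axis.  Composing [h]
    with the inverse stereographic projection [y (1 - m, 2 x)], where
    [m = |x|^2], gives the map
      [(x, y) |-> y^2 ((1 - m)^2 - 4 m, 4 (1 - m) x)],
    of norm [(y (1 + m))^2], and [x] alone already reaches every direction.  It
    remains to parametrize [{y (1 + m) >= 1}] polynomially over [x]: since
    [1 + 2 m = -1] modulo [1 + m], the polynomial
      [1 + (1 + 2 m) (1 + (1 + m) t)^2]
    is divisible by [1 + m], and for fixed [x] it takes exactly the values
    [>= 1]. *)

Import Order.TTheory GRing.Theory Num.Theory.

(** The quotient by [1 + m] of the divisible polynomial. The ring is arbitrary so that one formula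
    serves both for polynomials and for their values. *)
Definition height {A : comNzRingType} (m t : A) : A :=
  2 + (1 + 2 * m) * (2 * t + (1 + m) * t ^+ 2).

Lemma heightM (A : comNzRingType) (m t : A) :
  height m t * (1 + m) = 1 + (1 + 2 * m) * (1 + (1 + m) * t) ^+ 2.
Proof. rewrite /height; ring. Qed.

Section Directions.
Context {R : rcfType}.

Lemma height_ge1 (m t : R) : 0 <= m -> 1 <= height m t * (1 + m).
Proof.
by move=> m0; rewrite heightM lerDl mulr_ge0 ?sqr_ge0// addr_ge0 ?mulr_ge0.
Qed.

Lemma height_surj (m w : R) : 0 <= m -> 1 <= w ->
  exists t, height m t * (1 + m) = w.
Proof.
move=> m0 w1.
have m1 : 1 + m != 0 by apply/eqP; lra.
have m2 : 1 + 2 * m != 0 by apply/eqP; lra.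
(* Solves [(1 + (1 + m) t)^2 = (w - 1) / (1 + 2 m)] for [t]. *)
exists ((Num.sqrt ((w - 1) / (1 + 2 * m)) - 1) / (1 + m)).
rewrite heightM [(1 + m) * _]mulrC divfK// [1 + (_ - 1)]addrC subrK.
rewrite sqr_sqrtr; last by rewrite divr_ge0//; lra.
by rewrite [(1 + 2 * m) * _]mulrC divfK// addrC subrK.
Qed.

Lemma direction_surj (I : finType) (P : pred I) (j : I) (alpha : R)
    (beta : I -> R) : P j -> alpha ^+ 2 + \sum_(i | P i) beta i ^+ 2 = 1 ->
  exists x : I -> R, let m := \sum_(i | P i) x i ^+ 2 in
    (1 - m) ^+ 2 - 4 * m = (1 + m) ^+ 2 * alpha /\
    forall i, P i -> 4 * (1 - m) * x i = (1 + m) ^+ 2 * beta i.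
Proof.
move=> Pj ab1.
have b0 : 0 <= \sum_(i | P i) beta i ^+ 2 by apply: sumr_ge0 => i _; exact: sqr_ge0.
(* At [alpha = -1] the divisor [a] used below would vanish; there [beta = 0] on [P], and any [x]
   with [m = 1] works. *)
have [alphaN1|alphaN1] := eqVneq alpha (-1).
  have /eqP : \sum_(i | P i) beta i ^+ 2 = 0 by move: ab1; rewrite alphaN1; lra.
  rewrite psumr_eq0; last by move=> i _; exact: sqr_ge0.
  move=> /allP beta0.
  exists (fun i => (i == j)%:R) => m.
  have m1 : m = 1.
    rewrite /m (bigD1 j)//= eqxx big1 ?addr0 ?expr1n// => i /andP[_ /negbTE->].
    by rewrite expr0n.
  rewrite m1 alphaN1; split; first by ring.
  move=> i Pi; have := beta0 i (mem_index_enum i).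
  by rewrite Pi sqrf_eq0 => /eqP ->; ring.
have alpha_gtN1 : 0 < 1 + alpha.
  have : 1 + alpha != 0 by rewrite addrC; apply: contra alphaN1; rewrite addr_eq0.
  have : 0 <= 1 + alpha by nra.
  by move=> h1 h2; rewrite lt_neqAle eq_sym h2.
(* [(a, beta / (2 a))] is the [h]-preimage of [(alpha, beta)] with [a > 0]. *)
pose a := Num.sqrt ((1 + alpha) / 2).
have a0 : 0 < a by rewrite sqrtr_gt0; lra.
have a2 : alpha = 2 * a ^+ 2 - 1 by rewrite sqr_sqrtr; lra.
have an0 : a != 0 by rewrite gt_eqF.
have a1n0 : 1 + a != 0 by rewrite gt_eqF//; lra.
(* Stereographic projection of [(a, beta / (2 a))] from [(-1, 0)]. *)
exists (fun i => beta i / (2 * a * (1 + a))) => m.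
have mE : m = (1 - a) / (1 + a).
  rewrite /m; under eq_bigr do rewrite expr_div_n.
  rewrite -mulr_suml.
  have -> : \sum_(i | P i) beta i ^+ 2 = 1 - alpha ^+ 2 by lra.
  by rewrite a2; field; rewrite an0 a1n0.
rewrite mE a2; split; first by field.
by move=> i _; field; rewrite an0 a1n0.
Qed.

End Directions.

Section Exterior.
Context {R : realType} {k : nat}.
Implicit Types (x c p : 'rV[R]_k.+1) (r : R).

Definition tail_sqr {A : comNzRingType} (x : 'I_k.+1 -> A) : A :=
  \sum_(i | i != ord0) x i ^+ 2.

(* The coordinate [x ord0] plays the role of [t]. *)
Definition exterior_coord {A : comNzRingType} (x : 'I_k.+1 -> A) i : A :=
  let m := tail_sqr x in
  height m (x ord0) ^+ 2 *
    (if i == ord0 then (1 - m) ^+ 2 - 4 * m else 4 * (1 - m) * x i).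

Definition exterior_map c r x : 'rV[R]_k.+1 :=
  \row_i (c 0 i + r * exterior_coord (x 0) i).

Lemma meval_exterior_coord (v : 'I_k.+1 -> R) i :
  (exterior_coord (fun j => 'X_j) i).@[v] =
  exterior_coord v i.
Proof.
have mE : (tail_sqr (fun j => 'X_j)).@[v] = tail_sqr v.
  by rewrite rmorph_sum; apply: eq_bigr => j _; rewrite rmorphXn /= mevalXU.
rewrite /exterior_coord /height; case: ifP => _;
  by rewrite !(rmorphM, rmorphXn, rmorphB, rmorphD, rmorph1, rmorph_nat) /=
    ?mevalXU mE.
Qed.

Lemma polynomial_exterior_map c r : polynomial_map (exterior_map c r).
Proof.
exists (fun i => (c 0 i)%:MP +
  r%:MP * exterior_coord (fun j => 'X_j) i) => x i.
by rewrite mxE rmorphD rmorphM /= !mevalC meval_exterior_coord.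
Qed.

Lemma tail_sqr_ge0 (v : 'I_k.+1 -> R) : 0 <= tail_sqr v.
Proof. by apply: sumr_ge0 => i _; exact: sqr_ge0. Qed.

(** This is [|h z| = |z|^2] in the form [((1 - m)^2 - 4 m)^2 + 16 m (1 - m)^2 = (1 + m)^4]. *)
Lemma sum_sqr_exterior_coord (v : 'I_k.+1 -> R) :
  let m := tail_sqr v in
  \sum_i exterior_coord v i ^+ 2 =
  ((height m (v ord0) * (1 + m)) ^+ 2) ^+ 2.
Proof.
move=> m; rewrite (bigD1 ord0)//= {1}/exterior_coord eqxx -/m.
set y := height m _.
have -> : \sum_(i | i != ord0) exterior_coord v i ^+ 2 =
    (y ^+ 2 * (4 * (1 - m))) ^+ 2 * m.
  rewrite {2}/m /tail_sqr mulr_sumr; apply: eq_bigr => i /negbTE i0.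
  by rewrite /exterior_coord i0 -/m -/y mulrA exprMn.
by ring.
Qed.

Lemma enorm_exterior_map c r x : 0 < r ->
  let m := tail_sqr (x 0) in
  enorm (exterior_map c r x - c) =
  r * (height m (x 0 ord0) * (1 + m)) ^+ 2.
Proof.
move=> r0 m; rewrite /enorm.
under eq_bigr => i _ do rewrite !mxE addrAC subrr add0r exprMn.
rewrite -mulr_sumr sum_sqr_exterior_coord -exprMn sqrtr_sqr ger0_norm//.
by rewrite mulr_ge0 ?sqr_ge0// ltW.
Qed.

(** The tail of [x] is chosen first, to match the direction of [p - c]. This fixes [m], and [t] then
    adjusts the norm without changing [m]. *)
Lemma exterior_map_surj c r p : (0 < k)%N -> 0 < r ->
  r <= enorm (p - c) -> exists x, exterior_map c r x = p.
Proof.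
move=> k0 r0; set D := enorm _ => rD.
have D0 : 0 < D := lt_le_trans r0 rD.
have Dn0 : D != 0 by rewrite gt_eqF.
have rn0 : r != 0 by rewrite gt_eqF.
have D2 : D ^+ 2 = \sum_i (p - c) 0 i ^+ 2.
  by rewrite sqr_sqrtr//; apply: sumr_ge0 => i _; exact: sqr_ge0.
have unit_pc : ((p - c) 0 ord0 / D) ^+ 2 +
    \sum_(i : 'I_k.+1 | i != ord0) ((p - c) 0 i / D) ^+ 2 = 1.
  transitivity (\sum_i ((p - c) 0 i / D) ^+ 2); first by rewrite [RHS](bigD1 ord0).
  under eq_bigr do rewrite expr_div_n.
  by rewrite -mulr_suml -D2 divff// expf_neq0.
(* A second coordinate exists since [0 < k]. *)
have j0 : (inord 1 : 'I_k.+1) != ord0 by rewrite -val_eqE /= inordK.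
have [u [uE0 uE]] :=
  direction_surj _ (fun i => i != ord0) (inord 1) _ _ j0 unit_pc.
move: uE0 uE; set m := \sum_(i | _) _ => uE0 uE.
have m0 : 0 <= m := tail_sqr_ge0 u.
(* The norm is [r] times the square of [height m t * (1 + m)], so the value to reach is
   [sqrt (D / r)]. *)
have s1 : 1 <= Num.sqrt (D / r).
  by rewrite -sqrtr1 ler_wsqrtr// ler_pdivlMr// mul1r.
have [t tE] := height_surj _ _ m0 s1.
have yE : height m t ^+ 2 * (1 + m) ^+ 2 = D / r.
  by rewrite -exprMn tE sqr_sqrtr// divr_ge0// ltW.
pose x : 'rV[R]_k.+1 := \row_i if i == ord0 then t else u i.
have xm : tail_sqr (x 0) = m.
  by apply: eq_bigr => i /negbTE i0; rewrite mxE i0.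
exists x; apply/rowP => i; rewrite mxE.
have -> : exterior_coord (x 0) i = (p - c) 0 i / r.
  rewrite /exterior_coord xm !mxE eqxx.
  case: eqP => [->|/eqP i0]; rewrite ?uE0 ?uE// mulrA yE !mxE;
    by field; rewrite rn0 Dn0.
by rewrite !mxE; field.
Qed.

End Exterior.

Theorem proposition7p1 (R : realType) (n : nat) (hn : (2 <= n)%N)
  (c : 'rV[R]_n) (r : R) (hr : 0 < r) :
  polynomial_image n (~` open_eball c r).
Proof.
case: n hn c => [//|k] k0 c.
exists (exterior_map c r); first exact: polynomial_exterior_map.
apply/seteqP; split => [p /= /negP|_ [x _ <-] /=].
  rewrite -leNgt => /(exterior_map_surj _ _ _ k0 hr)[x <-].
  by exists x.
apply/negP; rewrite -leNgt enorm_exterior_map// ler_peMr ?(ltW hr)//.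
by rewrite exprn_ege1// height_ge1// tail_sqr_ge0.
Qed.
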